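(* Consider the online game of arbitrary length $T$ (fixed in advance, unknown to the player): vectors $v_1,\ldots,v_T$ are independent and uniform on $\{-1,+1\}^n$ and signs $x_t\in\{-1,+1\}$ are chosen by the majority rule described in the context. Let $V(n,T)=\left|\sum_{t=1}^T x_tv_t\right|_\infty$. Then $\mathbb{E}[V(n,T)] = O(\sqrt{n}\ln n)$ (with an absolute implied constant, independent of $T$). More precisely, there is an absolute constant $a>0$ such that for all $k>0$ the probability that some coordinate $i$ has $|P_T(i)|\ge k\sqrt n$ is at most $n e^{-ak}$ (up to an absolute constant factor).
   Context: Let $P_t=\sum_{s=1}^t x_sv_s$ with $P_0=0$, and $P_t(i)$ its $i$-th coordinate. Majority rule: at round $t$, let $N_+=\#\{i: P_{t-1}(i)\ne0,\ v_t(i)P_{t-1}(i)>0\}$ and $N_-=\#\{i: P_{t-1}(i)\ne0,\ v_t(i)P_{t-1}(i)<0\}$. If $N_+>N_-$ choose $x_t=-1$, if $N_->N_+$ choose $x_t=+1$ (in either case the strict majority of the nonzero coordinates move toward zero in absolute value), and if $N_+=N_-$ choose $x_t$ uniformly at random, independently of everything else. *)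

(* Defs.v *)
From HB Require Import structures.
From mathcomp Require Import all_boot all_order all_algebra.
From mathcomp Require Import all_classical all_reals all_analysis.

Set Implicit Arguments.
Unset Strict Implicit.
Unset Printing Implicit Defensive.

Import Order.TTheory GRing.Theory Num.Theory.
Import numFieldNormedType.Exports.
Local Open Scope classical_set_scope.
Local Open Scope ring_scope.

(* A sign is encoded by a boolean b, standing for (-1) ^+ b: false is +1 and  *)
(* true is -1. Accordingly {-1,+1}^n is the finite type of functions from     *)
(* 'I_n to bool, embedded in R^n by [signrow].                                *)
Definition signvec (n : nat) : finType := {ffun 'I_n -> bool}.

Definition signrow (R : realType) (n : nat) (v : signvec n) : 'rV[R]_n :=
  \row_i (-1) ^+ v i.

(* [p] is the current position P_{t-1} and [u] the incoming vector v_t. *)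
Definition Nplus (R : realType) (n : nat) (p u : 'rV[R]_n) : nat :=
  #|[pred i : 'I_n | (p ord0 i != 0) && (0 < u ord0 i * p ord0 i)]|.

Definition Nminus (R : realType) (n : nat) (p u : 'rV[R]_n) : nat :=
  #|[pred i : 'I_n | (p ord0 i != 0) && (u ord0 i * p ord0 i < 0)]|.

(* [c] is the outcome of the coin of the round, consulted only on a tie. *)
Definition majority_sign (R : realType) (n : nat) (p u : 'rV[R]_n) (c : bool)
    : R :=
  if (Nminus p u < Nplus p u)%N then -1
  else if (Nplus p u < Nminus p u)%N then 1
  else (-1) ^+ c.

(* Rounds are numbered from 0, so that [v t] and [c t] are the vector and the *)
(* coin of the (t+1)-st round; [position R v c t] is P_t, the signed sum of   *)
(* the first t vectors.                                                       *)
Fixpoint position (R : realType) (n : nat) (v : nat -> signvec n)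
    (c : nat -> bool) (t : nat) : 'rV[R]_n :=
  if t is t'.+1 then
    let p := position R v c t' in
    let u := signrow R (v t') in
    p + majority_sign p u (c t') *: u
  else 0.

Definition played_sign (R : realType) (n : nat) (v : nat -> signvec n)
    (c : nat -> bool) (t : nat) : R :=
  majority_sign (position R v c t) (signrow R (v t)) (c t).

Lemma positionE (R : realType) (n : nat) (v : nat -> signvec n)
    (c : nat -> bool) (t : nat) :
  position R v c t = \sum_(s < t) played_sign R v c s *: signrow R (v s).
Proof.
by elim: t => [|t IHt]; rewrite ?big_ord0// big_ord_recr/= -IHt.
Qed.

(* The norm of 'rV[R]_n is the sup norm; see [game_valueE]. *)
Definition game_value (R : realType) (n : nat) (v : nat -> signvec n)
    (c : nat -> bool) (T : nat) : R :=
  `|\sum_(t < T) played_sign R v c t *: signrow R (v t)|.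

Lemma game_valueE (R : realType) (n : nat) (v : nat -> signvec n)
    (c : nat -> bool) (T : nat) :
  game_value R v c T = \big[Num.max/0]_(i < n) `|position R v c T ord0 i|.
Proof.
rewrite /game_value -positionE [LHS]mx_normrE.
apply/le_anti/andP; split; apply/bigmax_leP; split; rewrite ?bigmax_ge_id//.
- move=> [i j] _ /=; rewrite (ord1 i).
  exact: (le_bigmax _ (fun j => `|position R v c T ord0 j|) j).
- move=> j _.
  exact: (le_bigmax _ (fun ij => `|position R v c T ij.1 ij.2|) (ord0, j)).
Qed.

Definition discrete_rv (d : measure_display) (Omega : measurableType d)
    (E : finType) (X : Omega -> E) : Prop :=
  forall e : E, measurable (X @^-1` [set e]).

Definition uniform_rv (d : measure_display) (Omega : measurableType d)
    (R : realType) (P : probability Omega R) (E : finType) (X : Omega -> E)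
    : Prop :=
  forall e : E, P (X @^-1` [set e]) = (#|E|%:R^-1)%:E.

(* Mutual independence of the finite family X_0, ..., X_{T-1}, Y_0, ...,      *)
(* Y_{T-1}. Taking some of the A t, B t to be the full set gives the product  *)
(* rule for every subfamily.                                                  *)
Definition mutually_independent (d : measure_display)
    (Omega : measurableType d) (R : realType) (P : probability Omega R)
    (E F : finType) (T : nat) (X : nat -> Omega -> E) (Y : nat -> Omega -> F)
    : Prop :=
  forall (A : 'I_T -> set E) (B : 'I_T -> set F),
    P [set w | forall t : 'I_T, A t (X t w) /\ B t (Y t w)] =
    ((\prod_(t < T) P (X t @^-1` A t)) * (\prod_(t < T) P (Y t @^-1` B t)))%E.

(* The randomness of a game of length T: only the first T rounds are          *)
(* constrained.                                                               *)
Record random_game (d : measure_display) (Omega : measurableType d)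
    (R : realType) (P : probability Omega R) (n T : nat)
    (v : nat -> Omega -> signvec n) (c : nat -> Omega -> bool) : Prop :=
  RandomGame {
    vectors_measurable : forall t, (t < T)%N -> discrete_rv (v t);
    coins_measurable : forall t, (t < T)%N -> discrete_rv (c t);
    vectors_uniform : forall t, (t < T)%N -> uniform_rv P (v t);
    coins_uniform : forall t, (t < T)%N -> uniform_rv P (c t);
    vectors_coins_independent : mutually_independent P T v c
  }.

(* Main.v *)
Require Import Defs.
From HB Require Import structures.
From mathcomp Require Import all_boot all_order all_algebra.
From mathcomp Require Import all_classical all_reals all_analysis.
From mathcomp Require Import fingroup perm measurable_realfun ring lra.

Set Implicit Arguments.
Unset Strict Implicit.
Unset Printing Implicit Defensive.

Import Order.TTheory GRing.Theory Num.Theory.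
Import numFieldNormedType.Exports.
Local Open Scope classical_set_scope.
Local Open Scope ring_scope.

(* Relative to the signs of the m nonzero coordinates of the position, the    *)
(* incoming vector is a uniform sign vector with sum S. By symmetry a nonzero *)
(* coordinate drifts toward 0 by E|S| / m per round, and E|S| >= sqrt m / 2   *)
(* by comparison with the second and fourth moments of S, so the drift is at  *)
(* least 1 / (2 sqrt n). Hence, with l = 1 / (4 sqrt n), the potential        *)
(* f x = exp (l x) + exp (- l x) of a coordinate satisfies                    *)
(*   E f (P_{t+1} i) <= (1 - l^2) E f (P_t i) + 8 l^2,                        *)
(* so that E f (P_t i) <= 8 for all t. Markov's inequality and a union bound  *)
(* give the tail estimate; for the expectation, exp (l V) is at most the sum  *)
(* of the n potentials.                                                       *)

(** The rule plays minus the majority of the signs taken relative to the position. A nonzero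
    coordinate thus moves outward by minus the correlation of one sign with the majority of m signs,
    which is of order [1 / sqrt m] ([sum_signmaj_ge], [sum_move_coord_le]). Steps have size 1, so an
    inward drift of order [1 / sqrt n] balances diffusion at height [sqrt n], and an exponential
    potential on that scale keeps a bounded mean for all time ([sum_potential_step],
    [sum_potential_le]). The coordinates are coupled, but each is treated alone and they meet only
    in the final sum over i. Probability is reduced to counting: the T rounds form one uniform
    variable on a finite set ([uniform_rounds_of]), and conditioning on the past becomes resampling
    one round ([sum_resample]). *)

Section Rademacher.
Variables (R : realType) (n : nat).
Implicit Types (u : signvec n) (i j : 'I_n) (s : seq 'I_n).

Definition flip i u : signvec n := [ffun j => u j (+) (j == i)].

Lemma flipK i : involutive (flip i).
Proof. by move=> u; apply/ffunP => j; rewrite !ffunE -addbA addbb addbF. Qed.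

(** Flipping coordinate i pairs terms of opposite sign. This plays the role of independence of a
    centred sign from the other coordinates. *)
Lemma sum_sign_mul_eq0 i (G : signvec n -> R) :
  (forall u, G (flip i u) = G u) -> \sum_(u : signvec n) (-1) ^+ u i * G u = 0.
Proof.
move=> Gflip; set s := LHS.
suff : s = - s by move=> ?; lra.
rewrite {1}/s (reindex_inj (inv_inj (flipK i))) /= -sumrN.
apply: eq_bigr => u _; rewrite Gflip ffunE eqxx addbT signrN.
by rewrite mulNr.
Qed.

Definition signsum s u : R := \sum_(j <- s) (-1) ^+ u j.

Lemma signsum_flip i s u : i \notin s -> signsum s (flip i u) = signsum s u.
Proof.
move=> ins; rewrite /signsum !big_seq; apply: eq_bigr => j js.
by rewrite ffunE (negbTE (memPn ins j js)) addbF.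
Qed.

Lemma sum_signsum_sqr s : uniq s ->
  \sum_(u : signvec n) signsum s u ^+ 2 = (size s)%:R * #|signvec n|%:R.
Proof.
elim: s => [_|i s IHs /andP[ins us]].
  by rewrite mul0r big1// => u _; rewrite /signsum big_nil expr0n.
rewrite (eq_bigr (fun u => (1 + signsum s u ^+ 2)
                         + (-1) ^+ u i * (2 * signsum s u))); last first.
  move=> u _; rewrite /signsum big_cons.
  have := sqrr_sign R (u i); move: ((-1) ^+ u i) => x; rewrite expr2 => xx.
  by set y := \sum_(j <- s) _; ring: xx.
rewrite big_split/= big_split/= IHs// sum_sign_mul_eq0; last first.
  by move=> u; rewrite signsum_flip.
by rewrite sumr_const cardT -cardE /= -(natr1 (size s)); ring.
Qed.

(** Odd powers of the new sign average to 0, so one more sign adds [1 + 6 m] to the fourth moment,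
    less than the increase [6 m + 3] of [3 m ^ 2]. *)
Lemma sum_signsum_pow4 s : uniq s ->
  \sum_(u : signvec n) signsum s u ^+ 4 <= 3 * (size s)%:R ^+ 2 * #|signvec n|%:R.
Proof.
elim: s => [_|i s IHs /andP[ins us]].
  by rewrite expr0n mulr0 mul0r big1// => u _; rewrite /signsum big_nil expr0n.
rewrite (eq_bigr (fun u => (1 + 6 * signsum s u ^+ 2 + signsum s u ^+ 4)
    + (-1) ^+ u i * (4 * signsum s u + 4 * signsum s u ^+ 3))); last first.
  move=> u _; rewrite /signsum big_cons.
  have := sqrr_sign R (u i); move: ((-1) ^+ u i) => x; rewrite expr2 => xx.
  by set y := \sum_(j <- s) _; ring: xx.
rewrite big_split/= !big_split/= -mulr_sumr sum_signsum_sqr//.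
rewrite sum_sign_mul_eq0; last by move=> u; rewrite signsum_flip.
rewrite sumr_const cardT -cardE /= -(natr1 (size s)).
have := IHs us; have : 0 <= #|signvec n|%:R :> R by [].
set N := #|_|%:R; set S := \sum_i _; set m := (size s)%:R => N0.
by move=> SN; nra.
Qed.

(** With [r = sqrt m], average the pointwise bound [16 r^3 |S| >= 12 r^2 S^2 - S^4]. The two moments
    leave at least [9 r^4] on the right, so the mean of [|S|] is at least [9 r / 16]. *)
Lemma sum_normr_signsum s : uniq s ->
  Num.sqrt (size s)%:R / 2 * #|signvec n|%:R <= \sum_(u : signvec n) `|signsum s u|.
Proof.
move=> us; have [->|s0] := eqVneq (size s) 0%N.
  by rewrite sqrtr0 !mul0r; apply: sumr_ge0.
set N : R := #|signvec n|%:R; set r : R := Num.sqrt (size s)%:R.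
have r0 : 0 < r by rewrite sqrtr_gt0 ltr0n lt0n.
have rm : r ^+ 2 = (size s)%:R by rewrite sqr_sqrtr.
(* [16 r^3 y - 12 r^2 y^2 + y^4 = y (y - 2 r)^2 (y + 4 r)] *)
have quartic u : 12 * r ^+ 2 * signsum s u ^+ 2 - signsum s u ^+ 4
    <= 16 * r ^+ 3 * `|signsum s u|.
  have -> : signsum s u ^+ 4 = `|signsum s u| ^+ 4.
    by rewrite -normrX ger0_norm// exprn_even_ge0.
  rewrite -(real_normK (num_real (signsum s u))).
  set y := `|signsum s u|; have y0 : 0 <= y := normr_ge0 _.
  rewrite -subr_ge0; have -> : 16 * r ^+ 3 * y - (12 * r ^+ 2 * y ^+ 2 - y ^+ 4)
    = y * (y - 2 * r) ^+ 2 * (y + 4 * r) by ring.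
  by apply: mulr_ge0; [apply: mulr_ge0 => //; exact: sqr_ge0 | lra].
have : \sum_(u : signvec n) (12 * r ^+ 2 * signsum s u ^+ 2 - signsum s u ^+ 4)
    <= \sum_(u : signvec n) 16 * r ^+ 3 * `|signsum s u| by apply: ler_sum.
rewrite big_split/= sumrN -!mulr_sumr sum_signsum_sqr//.
have := sum_signsum_pow4 us; rewrite -rm -/N.
set S := \sum_(u : signvec n) `|_|; set S4 := \sum_(u : signvec n) _ ^+ 4.
move=> S4_le ineq.
have N0 : 0 <= N by [].
rewrite -(ler_pM2l (exprn_gt0 3 r0)).
have : 0 <= r ^+ 4 * N by rewrite mulr_ge0// exprn_ge0// ltW.
have -> : r ^+ 3 * (r / 2 * N) = r ^+ 4 * N / 2 by field.
have : 9 * (r ^+ 4 * N) <= 16 * (r ^+ 3 * S).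
  have -> : 9 * (r ^+ 4 * N) = 12 * r ^+ 2 * (r ^+ 2 * N) - 3 * (r ^+ 2) ^+ 2 * N.
    by ring.
  by lra.
by lra.
Qed.

Definition permsign (p : {perm 'I_n}) u : signvec n := [ffun j => u (p j)].

Lemma permsign_inj p : injective (permsign p).
Proof.
move=> u u' /ffunP uu'; apply/ffunP => j.
by have := uu' (p^-1%g j); rewrite !ffunE permKV.
Qed.

Definition signmaj s u : R := Num.sg (signsum s u).

(** The transposition of i and j permutes [s], hence preserves the sum and its sign. *)
Lemma sum_signmaj_sym s i j : i \in s -> j \in s -> uniq s ->
  \sum_(u : signvec n) signmaj s u * (-1) ^+ u i =
  \sum_(u : signvec n) signmaj s u * (-1) ^+ u j.
Proof.
move=> si sj us.
rewrite (reindex_inj (@permsign_inj (tperm i j))) /=.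
apply: eq_bigr => u _; rewrite ffunE tpermL; congr (Num.sg _ * _).
rewrite /signsum (eq_bigr (fun k => (-1) ^+ u (tperm i j k))); last first.
  by move=> k _; rewrite ffunE.
rewrite -(big_map (tperm i j) xpredT (fun k => (-1) ^+ u k)).
apply: perm_big; apply: uniq_perm => //.
  by rewrite map_inj_uniq//; exact: perm_inj.
move=> k; apply/mapP/idP => [[l ls ->]|ks].
  by case: tpermP => // ->.
by exists (tperm i j k); [case: tpermP => // -> | rewrite tpermK].
Qed.

(* By symmetry the correlation is the same for all coordinates of [s], and    *)
(* these correlations add up to the mean of [`|signsum s|].                   *)
Lemma sum_signmaj_ge s i : uniq s -> i \in s ->
  #|signvec n|%:R / (2 * Num.sqrt (size s)%:R)
    <= \sum_(u : signvec n) signmaj s u * (-1) ^+ u i.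
Proof.
move=> us si; set c := leRHS; set N : R := #|_|%:R.
have s0 : (0 < size s)%N by case: s si {us c}.
set r : R := Num.sqrt _; have r0 : 0 < r by rewrite sqrtr_gt0 ltr0n.
have rm : r ^+ 2 = (size s)%:R by rewrite sqr_sqrtr.
have cE : (size s)%:R * c = \sum_(u : signvec n) `|signsum s u|.
  transitivity (\sum_(j <- s) \sum_(u : signvec n) signmaj s u * (-1) ^+ u j).
    rewrite big_seq (eq_bigr (fun=> c)).
      by rewrite -big_seq big_const_seq count_predT iter_addr_0 mulr_natl.
    by move=> j sj; rewrite /c (sum_signmaj_sym si sj).
  rewrite exchange_big /=; apply: eq_bigr => u _.
  by rewrite -mulr_sumr /signmaj normrEsg.
have := sum_normr_signsum us; rewrite -/r -/N -cE -rm => h.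
rewrite ler_pdivrMr; last by lra.
by rewrite -(ler_pM2l r0); lra.
Qed.

End Rademacher.

(** * Drift of a nonzero coordinate toward zero in one round *)

Section Drift.
Variables (R : realType) (n : nat) (p : 'rV[R]_n).
Implicit Types (u : signvec n) (i j : 'I_n).

Definition nonzero_coords : seq 'I_n := enum [pred j | p ord0 j != 0].

(** On a nonzero coordinate this encodes whether [u] points away from 0 ([false]) or toward 0
    ([true]). Being an involution of all sign vectors, it preserves the uniform law. *)
Definition relsign u : signvec n := [ffun j => u j (+) (p ord0 j < 0)].

Lemma relsignK : involutive relsign.
Proof. by move=> u; apply/ffunP => j; rewrite !ffunE -addbA addbb addbF. Qed.

Lemma relsignE u j : p ord0 j != 0 ->
  (-1) ^+ relsign u j = (-1) ^+ u j * Num.sg (p ord0 j) :> R.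
Proof. by move=> pj; rewrite ffunE signr_addb sgr_def pj mulr1n. Qed.

Lemma Nplus_sub_Nminus u :
  (Nplus p (signrow R u))%:R - (Nminus p (signrow R u))%:R
  = signsum R nonzero_coords (relsign u).
Proof.
rewrite /Nplus /Nminus /signsum /nonzero_coords big_enum /=.
rewrite -!sum1_card !natr_sum big_mkcond [in X in _ - X]big_mkcond.
rewrite [in RHS]big_mkcond -sumrB/=; apply: eq_bigr => j _.
rewrite !inE !mxE; have [->|pj] := eqVneq; first by rewrite subr0.
rewrite relsignE//= sgr_def pj mulr1n /=.
case: (u j) => /=; rewrite ?expr1 ?expr0 ?mulN1r ?mul1r ?oppr_gt0 ?oppr_lt0;
  by case: ltgtP pj => //= _ _; rewrite ?expr1 ?expr0; lra.
Qed.

(** The two coin outcomes cancel on a tie, matching [Num.sg 0 = 0], and agree otherwise, whence the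
    factor 2. *)
Lemma sum_majority_sign u :
  \sum_(c : bool) majority_sign p (signrow R u) c
  = - 2 * signmaj R nonzero_coords (relsign u).
Proof.
rewrite big_bool /majority_sign /signmaj -Nplus_sub_Nminus -!(ltr_nat R).
case: (ltgtP (Nminus p _)%:R) => [lt|lt|->] /=.
- by rewrite gtr0_sg ?subr_gt0//; lra.
- by rewrite ltr0_sg ?subr_lt0//; lra.
- by rewrite subrr sgr0 expr1 expr0; lra.
Qed.

Lemma majority_sign_cases u c :
  majority_sign p (signrow R u) c = 1 \/ majority_sign p (signrow R u) c = -1.
Proof.
rewrite /majority_sign; case: ifP => _; first by right.
by case: ifP => _; [left | case: c; [right | left]].
Qed.

Definition move_coord i (x : signvec n * bool) : R :=
  majority_sign p (signrow R x.1) x.2 * (-1) ^+ x.1 i.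

Lemma move_coord_cases i x : move_coord i x = 1 \/ move_coord i x = -1.
Proof.
rewrite /move_coord; case: (x.1 i) (majority_sign_cases x.1 x.2) => -[]->;
  rewrite ?expr0 ?expr1 ?mulr1 ?mulrN1 ?opprK; by [left|right].
Qed.

(** Passing to relative signs turns the outward mean move into minus the majority correlation among
    the m nonzero coordinates. The bound for m is then weakened using [m <= n]. *)
Lemma sum_move_coord_le i : p ord0 i != 0 ->
  Num.sg (p ord0 i) * (\sum_x move_coord i x)
  <= - (#|{: signvec n * bool}|%:R / (2 * Num.sqrt n%:R)).
Proof.
move=> pnz; have n0 : (0 < n)%N by case: (n) i {pnz} => // -[].
have us : uniq nonzero_coords by exact: enum_uniq.
have si : i \in nonzero_coords by rewrite mem_enum.
have sizen : (size nonzero_coords <= n)%N.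
  by rewrite -cardE -[leqRHS]card_ord max_card.
have size0 : (0 < size nonzero_coords)%N by case: nonzero_coords si.
have -> : Num.sg (p ord0 i) * (\sum_x move_coord i x) =
    - 2 * \sum_(u : signvec n) signmaj R nonzero_coords u * (-1) ^+ u i.
  rewrite (reindex_inj (inv_inj relsignK))/= !mulr_sumr.
  apply: etrans (esym (pair_bigA _ (fun u c => Num.sg (p ord0 i) *
    (majority_sign p (signrow R u) c * (-1) ^+ u i)))) _.
  apply: eq_bigr => u _; rewrite -mulr_sumr -mulr_suml sum_majority_sign relsignE//.
  by ring.
have := sum_signmaj_ge R us si; set S := \sum_(u : signvec n) _.
have sq : Num.sqrt (size nonzero_coords)%:R <= Num.sqrt n%:R :> R.
  by rewrite ler_sqrt ?ler_nat.
have sq0 : 0 < Num.sqrt (size nonzero_coords)%:R :> R by rewrite sqrtr_gt0 ltr0n.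
have : #|signvec n|%:R / (2 * Num.sqrt n%:R) <=
    #|signvec n|%:R / (2 * Num.sqrt (size nonzero_coords)%:R) :> R.
  by rewrite ler_wpM2l// lef_pV2 ?posrE; lra.
by rewrite card_prod card_bool natrM; lra.
Qed.

End Drift.

(** * The hyperbolic cosine potential *)

Section Potential.
Variables (R : realType) (l : R).

Definition potential (x : R) : R := expR (l * x) + expR (- (l * x)).

Lemma potential_ge0 x : 0 <= potential x.
Proof. by rewrite addr_ge0 ?expR_ge0. Qed.

Lemma expR_norm_le_potential x : 0 <= l -> expR (l * `|x|) <= potential x.
Proof.
move=> l0; rewrite /potential; case: (lerP 0 x) => x0.
  by rewrite ger0_norm// lerDl expR_ge0.
by rewrite ltr0_norm// mulrN lerDr expR_ge0.
Qed.

(** Addition formula for [2 cosh]. The step [e] enters linearly, so averaging needs only its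
    mean. *)
Lemma potentialD1 x e : e = 1 \/ e = -1 ->
  potential (x + e) = potential x * ((expR l + expR (- l)) / 2)
    + e * ((expR (l * x) - expR (- (l * x))) * ((expR l - expR (- l)) / 2)).
Proof.
by case=> ->; rewrite /potential mulrDr ?mulr1 ?mulrN1 opprD ?opprK !expRD; field.
Qed.

(** Indeed [cosh y - |sinh y| = exp (- |y|) <= 1]. This converts the drift term, a multiple of
    [sinh], into a multiple of the potential up to a constant. *)
Lemma potential_sub2_le x : 0 <= l ->
  potential x - 2 <= Num.sg x * (expR (l * x) - expR (- (l * x))).
Proof.
move=> l0; rewrite /potential; have [x0|x0|<-] := ltgtP 0 x.
- rewrite gtr0_sg//; have : expR (- (l * x)) <= 1.
    by rewrite -expR0 ler_expR oppr_le0 mulr_ge0// ltW.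
  by lra.
- rewrite ltr0_sg//; have : expR (l * x) <= 1.
    by rewrite -expR0 ler_expR mulr_ge0_le0// ltW.
  by lra.
- by rewrite mulr0 oppr0 expR0 sgr0; lra.
Qed.

Lemma cosh_sinh_bounds : 0 < l <= 4^-1 ->
  (expR l + expR (- l)) / 2 - 2 * l * ((expR l - expR (- l)) / 2) <= 1 - l ^+ 2
  /\ 0 <= (expR l - expR (- l)) / 2 <= 2 * l.
Proof.
move=> /andP[l0 l4].
have h1 := expR_ge1Dx l; have h2 := expR_ge1Dx (- l).
(* From here only [a >= 1 + l], [b >= 1 - l] and [a b = 1] matter. They give [cosh l - 1 <= 2/3 l^2]
   and [2 l sinh l >= 9/5 l^2], and the difference exceeds [l^2]. *)
have := expRxMexpNx_1 l; move: (expR l) (expR (- l)) h1 h2 => a b h1 h2 ab.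
have a2 : a <= 4 / 3 by nra.
have al : a - 1 <= l * a by nra.
have bl : 4 / 5 * l <= 1 - b by nra.
have cosh_le : a + b - 2 <= l ^+ 2 * (4 / 3).
  have -> : a + b - 2 = (a - 1) * (1 - b) by ring: ab.
  by nra.
have sinh_ge : l * (9 / 5 * l) <= l * (a - b) by rewrite ler_wpM2l; lra.
have la : l * a <= l * (4 / 3) by rewrite ler_wpM2l; lra.
have l2 : 0 <= l ^+ 2 by exact: sqr_ge0.
split; first by rewrite expr2 in cosh_le l2 *; lra.
by apply/andP; split; lra.
Qed.

End Potential.

(** * Contraction of the mean potential in one round *)

Section Step.
Variables (R : realType) (n : nat).

(** With this scale the drift bound [1 / (2 sqrt n)] is exactly [2 l], and [l <= 1/4] for positive
    n. *)
Let l : R := (4 * Num.sqrt n%:R)^-1.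

Lemma sum_potential_step (p : 'rV[R]_n) i :
  \sum_(x : signvec n * bool) potential l (p ord0 i + move_coord p i x)
  <= #|{: signvec n * bool}|%:R * ((1 - l ^+ 2) * potential l (p ord0 i)
                                    + 8 * l ^+ 2).
Proof.
have n0 : (0 < n)%N by case: (n) i => // -[].
have r1 : 1 <= Num.sqrt n%:R :> R by rewrite -[leLHS]sqrtr1 ler_sqrt// ler1n.
have l0 : 0 < l by rewrite invr_gt0; lra.
have l4 : l <= 4^-1 by rewrite lef_pV2 ?posrE; lra.
have l2 : (2 * Num.sqrt n%:R)^-1 = 2 * l by rewrite /l; field; rewrite gt_eqF//; lra.
have [ch /andP[sh0 sh2]] := @cosh_sinh_bounds R l (introT andP (conj l0 l4)).
under eq_bigr do rewrite (potentialD1 _ _ (move_coord_cases _ _ _)).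
rewrite big_split/= sumr_const -mulr_suml -[_ *+ _]mulr_natl.
set ch' := (_ + _) / 2 in ch *; set sh := (_ - _) / 2 in ch sh0 sh2 *.
set N : R := #|{: signvec n * bool}|%:R; have N0 : 0 <= N by [].
have := potential_sub2_le (p ord0 i) (ltW l0); have := potential_ge0 l (p ord0 i).
set f := potential _ _; set g := expR _ - _ => f0 fg.
set S := \sum_x _.
(* At position 0 no drift is available, but there [g = 0] and [f = 2], so both sides vanish. *)
have Sg : S * g <= - N * (2 * l) * (f - 2).
  have [pnz|pnz] := eqVneq (p ord0 i) 0.
    by rewrite /g /f /potential pnz mulr0 oppr0 expR0 subrr !mulr0; lra.
  have := sum_move_coord_le pnz; rewrite l2 -/N -/S => S_le.
  have sg2 : Num.sg (p ord0 i) * Num.sg (p ord0 i) = 1 by rewrite -expr2 sqr_sg pnz.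
  have -> : S * g = (Num.sg (p ord0 i) * S) * (Num.sg (p ord0 i) * g) by ring: sg2.
  have g0 : 0 <= Num.sg (p ord0 i) * g.
    rewrite /g; case: (ltgtP 0 (p ord0 i)) => psg;
      rewrite ?(gtr0_sg psg) ?(ltr0_sg psg) -?psg ?sgr0 ?mul0r//.
      by rewrite mul1r subr_ge0 ler_expR; nra.
    by rewrite mulN1r oppr_ge0 subr_le0 ler_expR; nra.
  have Nl : 0 <= N * (2 * l) by rewrite mulr_ge0//; lra.
  by nra.
have Sgs : S * g * sh <= - N * (2 * l) * (f - 2) * sh by apply: ler_wpM2r.
have h1 : N * f * (ch' - 2 * l * sh) <= N * f * (1 - l ^+ 2).
  by rewrite ler_wpM2l// mulr_ge0.
(* The constant 2 in [f - 2] leaves [4 l sinh l], which yields the additive term [8 l^2]. *)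
have h2 : N * (4 * l) * sh <= N * (4 * l) * (2 * l).
  by rewrite ler_wpM2l// mulr_ge0//; lra.
by lra.
Qed.

End Step.

(** * Resampling one coordinate of a finite product *)

Section Resampling.
Variables (I X : finType) (t : I).

Definition resample (e : {ffun I -> X}) (x : X) : {ffun I -> X} :=
  [ffun s => if s == t then x else e s].

(* Swapping [x] with the coordinate [t] of [e] is an involution of the pairs  *)
(* [(e, x)].                                                                  *)
Lemma sum_resample (R : pzRingType) (G : {ffun I -> X} -> R) :
  \sum_e \sum_x G (resample e x) = #|X|%:R * \sum_e G e.
Proof.
pose swap (ex : {ffun I -> X} * X) := (resample ex.1 ex.2, ex.1 t).
have swapK : involutive swap.
  case=> e x; congr pair; last by rewrite ffunE eqxx.
  by apply/ffunP => s; rewrite !ffunE /=; case: eqP => // ->.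
rewrite mulr_sumr; transitivity (\sum_e \sum_(x : X) G e); last first.
  by apply: eq_bigr => e _; rewrite sumr_const mulr_natl.
by rewrite !pair_bigA /= [RHS](reindex_inj (inv_inj swapK)).
Qed.

End Resampling.

(** * The game on the finite space of all round sequences *)

Section FiniteGame.
Variables (R : realType) (n T : nat).

Definition rounds : finType := {ffun 'I_T -> signvec n * bool}.

Implicit Types (e : rounds) (x : signvec n * bool) (i : 'I_n).

(* Junk values are used beyond the last round. *)
Definition round_at e (t : nat) : signvec n * bool :=
  oapp e ([ffun=> false], false) (insub t).

Lemma round_atE e (t : 'I_T) : round_at e t = e t.
Proof. by rewrite /round_at valK. Qed.

Definition finite_position e (t : nat) : 'rV[R]_n :=
  position R (fst \o round_at e) (snd \o round_at e) t.

Lemma eq_position (v v' : nat -> signvec n) (c c' : nat -> bool) t :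
  (forall s, (s < t)%N -> v s = v' s /\ c s = c' s) ->
  position R v c t = position R v' c' t.
Proof.
elim: t => //= t IHt eqvc; have [-> ->] := eqvc t (ltnSn t).
by rewrite IHt// => s st; apply: eqvc; rewrite ltnS ltnW.
Qed.

(** Round t does not influence the position before it, so [x] acts as a fresh round independent of
    the past. *)
Lemma finite_position_resample e (t : 'I_T) x i :
  finite_position (resample t e x) t.+1 ord0 i =
  finite_position e t ord0 i + move_coord (finite_position e t) i x.
Proof.
rewrite /finite_position /= round_atE ffunE eqxx.
have -> : position R (fst \o round_at (resample t e x))
    (snd \o round_at (resample t e x)) t = finite_position e t.
  apply: eq_position => s st /=; have sT := ltn_trans st (ltn_ord t).
  have := round_atE (resample t e x) (Ordinal sT).
  have := round_atE e (Ordinal sT) => /= -> ->; rewrite ffunE.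
  by rewrite -val_eqE /= ltn_eqF.
by rewrite !mxE.
Qed.

(** The bound starts above the initial value 2, and 8 is the fixed point of
    [y |-> (1 - l^2) y + 8 l^2]; hence it does not grow with t. *)
Lemma sum_potential_le i (t : nat) : (t <= T)%N ->
  \sum_e potential (4 * Num.sqrt n%:R)^-1 (finite_position e t ord0 i)
    <= 8 * #|rounds|%:R :> R.
Proof.
have n0 : (0 < n)%N by case: (n) i => // -[].
set l : R := (4 * _)^-1; elim: t => [_|t IHt tT].
  rewrite (eq_bigr (fun=> 2)) => [|e _].
    by rewrite sumr_const -[_ *+ _]mulr_natr; apply: ler_wpM2r => //; lra.
  by rewrite /finite_position /= mxE /potential mulr0 oppr0 expR0.
have X0 : 0 < #|{: signvec n * bool}|%:R :> R.
  by rewrite ltr0n card_prod card_bool muln_gt0 andbT card_ffun card_bool expn_gt0.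
have l2 : 0 <= 1 - l ^+ 2.
  have r1 : 1 <= Num.sqrt n%:R :> R by rewrite -[leLHS]sqrtr1 ler_sqrt// ler1n.
  have l0 : 0 < l by rewrite invr_gt0; lra.
  have l4 : l <= 4^-1 by rewrite lef_pV2 ?posrE; lra.
  by nra.
rewrite -(ler_pM2l X0) -(sum_resample (Ordinal tT)) /=.
apply: (@le_trans _ _ (\sum_e #|{: signvec n * bool}|%:R *
  ((1 - l ^+ 2) * potential l (finite_position e t ord0 i) + 8 * l ^+ 2))).
  apply: ler_sum => e _; apply: le_trans (sum_potential_step _ _).
  by apply: ler_sum => x _; rewrite -(finite_position_resample e (Ordinal tT)).
rewrite -mulr_sumr ler_pM2l// big_split/= -mulr_sumr sumr_const -[_ *+ _]mulr_natr.
have := ler_wpM2l l2 (IHt (ltnW tT)).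
by lra.
Qed.

End FiniteGame.

(** * Expectations and probabilities of a uniform variable as finite averages *)

Section UniformVariable.
Variables (d : measure_display) (Omega : measurableType d) (R : realType).
Variables (P : probability Omega R) (E : finType) (X : Omega -> E).
Hypotheses (mX : discrete_rv X) (uX : uniform_rv P X).

Lemma discrete_rv_measurable (A : set E) : measurable (X @^-1` A).
Proof.
have -> : X @^-1` A = \bigcup_(e in A) X @^-1` [set e].
  by apply/seteqP; split => [w Aw|w [e Ae] /= -> //]; exists (X w).
by apply: fin_bigcup_measurable => [|e _]; [exact: finite_finset | exact: mX].
Qed.

Lemma expectation_uniform_rv (g : E -> R) : (forall e, 0 <= g e) ->
  ('E_P[g \o X])%E = ((\sum_e g e) / #|E|%:R)%:E.
Proof.
move=> g0; rewrite unlock.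
have mindic e : measurable_fun setT (fun w => (\1_(X @^-1` [set e]) w)%:E : \bar R).
  by apply/measurable_EFinP/measurable_indic/mX.
under eq_integral => w _.
  have -> : (g (X w))%:E = (\sum_e (g e)%:E * (\1_(X @^-1` [set e]) w)%:E)%E.
    rewrite (bigD1 (X w))//= big1 ?adde0 => [|e neq].
      by rewrite indicE mem_set// mule1.
    by rewrite indicE memNset ?mule0//= => /eqP; rewrite eq_sym (negbTE neq).
  over.
rewrite ge0_integral_sum//=; last 2 first.
- by move=> e; apply: emeasurable_funM; [exact: measurable_cst | exact: mindic].
- by move=> e w _; rewrite mule_ge0 ?lee_fin.
rewrite mulr_suml -sumEFin; apply: eq_bigr => e _.
rewrite ge0_integralZl_EFin// (integral_indic _ measurableT (mX e)) setIT EFinM.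
by congr (_ * _)%E; exact: uX.
Qed.

Lemma probability_uniform_rv (A : set E) :
  P (X @^-1` A) = ((\sum_e \1_A e) / #|E|%:R)%:E.
Proof.
rewrite -expectation_indic; last exact: discrete_rv_measurable.
rewrite -expectation_uniform_rv; last by move=> e; rewrite indicE.
by congr expectation; apply/funext => w; rewrite /= !indicE.
Qed.

End UniformVariable.

(** * Transfer to the random game and the two estimates *)

Section RandomGame.
Variables (d : measure_display) (Omega : measurableType d) (R : realType).
Variables (P : probability Omega R) (n T : nat).
Variables (v : nat -> Omega -> signvec n) (c : nat -> Omega -> bool).
Hypothesis game : random_game P T v c.

Definition rounds_of (w : Omega) : rounds n T := [ffun t : 'I_T => (v t w, c t w)].

Lemma preimage_rounds_of (e : rounds n T) :
  rounds_of @^-1` [set e] =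
  [set w | forall t : 'I_T, [set (e t).1] (v t w) /\ [set (e t).2] (c t w)].
Proof.
apply/seteqP; split => w /= => [<- t|vc]; first by rewrite ffunE.
by apply/ffunP => t; rewrite ffunE; have [-> ->] := vc t; case: (e t).
Qed.

Lemma discrete_rounds_of : discrete_rv rounds_of.
Proof.
move=> e; rewrite preimage_rounds_of.
have -> : [set w | forall t : 'I_T,
      [set (e t).1] (v t w) /\ [set (e t).2] (c t w)] =
    \bigcap_(t : 'I_T) (v t @^-1` [set (e t).1] `&` c t @^-1` [set (e t).2]).
  by apply/seteqP; split => w /= vc t; [move=> _|]; exact: vc.
apply: fin_bigcap_measurable; first exact: finite_finset.
move=> t _; apply: measurableI.
- exact: (vectors_measurable game (ltn_ord t)).
- exact: (coins_measurable game (ltn_ord t)).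
Qed.

Lemma card_rounds : #|rounds n T| = ((#|signvec n| * #|{: bool}|) ^ T)%N.
Proof. by rewrite card_ffun card_prod card_ord. Qed.

(** Mutual independence, applied to singletons, factors the probability of each round sequence into
    its uniform marginals. *)
Lemma uniform_rounds_of : uniform_rv P rounds_of.
Proof.
move=> e; rewrite preimage_rounds_of.
rewrite (vectors_coins_independent game (fun t => [set (e t).1])
  (fun t => [set (e t).2])).
under eq_bigr do rewrite (vectors_uniform game (ltn_ord _)).
under [X in (_ * X)%E]eq_bigr do rewrite (coins_uniform game (ltn_ord _)).
rewrite !prodEFin !prodr_const card_ord -EFinM -exprMn -invfM -natrM exprVn -natrX.
by rewrite card_rounds.
Qed.

Lemma position_rounds_of w :
  position R (v ^~ w) (c ^~ w) T = finite_position R (rounds_of w) T.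
Proof.
apply: eq_position => t tT /=.
by have := round_atE (rounds_of w) (Ordinal tT) => /= ->; rewrite ffunE.
Qed.

Let l : R := (4 * Num.sqrt n%:R)^-1.

Lemma sum_sum_potential_le :
  \sum_(e : rounds n T) \sum_i potential l (finite_position R e T ord0 i)
  <= 8 * n%:R * #|rounds n T|%:R.
Proof.
rewrite exchange_big /=.
have -> : 8 * n%:R * #|rounds n T|%:R = \sum_(i < n) (8 * #|rounds n T|%:R) :> R.
  by rewrite sumr_const card_ord -[RHS]mulr_natr; ring.
by apply: ler_sum => i _; exact: sum_potential_le.
Qed.

Lemma card_rounds_gt0 : 0 < #|rounds n T|%:R :> R.
Proof.
by rewrite ltr0n card_rounds card_ffun card_bool expn_gt0 muln_gt0 expn_gt0.
Qed.

Lemma position_tail (k : R) : (1 <= n)%N ->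
  (P [set w | exists i : 'I_n,
        (k * Num.sqrt n%:R <= `|position R (v ^~ w) (c ^~ w) T ord0 i|)%R]
     <= (8 * (n%:R * expR (- (4^-1 * k))))%:E)%E.
Proof.
move=> n1.
have r0 : 0 < Num.sqrt n%:R :> R by rewrite sqrtr_gt0 ltr0n.
have l0 : 0 < l by rewrite invr_gt0; lra.
have lr : l * (k * Num.sqrt n%:R) = 4^-1 * k.
  by rewrite /l; field; rewrite gt_eqF.
pose A := [set e : rounds n T | exists i : 'I_n,
  k * Num.sqrt n%:R <= `|finite_position R e T ord0 i|].
have -> : [set w | exists i : 'I_n,
    k * Num.sqrt n%:R <= `|position R (v ^~ w) (c ^~ w) T ord0 i|] =
    rounds_of @^-1` A.
  by apply/seteqP; split => w [i]; rewrite ?position_rounds_of => ki; exists i;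
    rewrite ?position_rounds_of.
rewrite (probability_uniform_rv discrete_rounds_of uniform_rounds_of) lee_fin.
rewrite ler_pdivrMr ?card_rounds_gt0//.
(* Markov's inequality and the union bound at once: on [A] some coordinate has potential at least
   [exp (k / 4)], and the other potentials are nonnegative. *)
apply: (@le_trans _ _ (\sum_(e : rounds n T) expR (- (4^-1 * k)) *
    \sum_i potential l (finite_position R e T ord0 i))).
  apply: ler_sum => e _; rewrite indicE; have [/set_mem [i ki]|_] := boolP (e \in A).
    apply: (@le_trans _ _ (expR (- (4^-1 * k)) *
      potential l (finite_position R e T ord0 i))).
      rewrite expRN mulrC ler_pdivlMr ?expR_gt0// mul1r.
      apply: le_trans (expR_norm_le_potential _ (ltW l0)).
      by rewrite ler_expR -lr ler_pM2l.
    rewrite ler_pM2l ?expR_gt0// (bigD1 i)//= lerDl.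
    by apply: sumr_ge0 => j _; exact: potential_ge0.
  by rewrite mulr_ge0 ?expR_ge0// sumr_ge0// => j _; exact: potential_ge0.
rewrite -mulr_sumr; have := ler_wpM2l (expR_ge0 (- (4^-1 * k))) sum_sum_potential_le.
by lra.
Qed.

(* The tangent line of the exponential at [ln (8 n)] bounds the maximum of    *)
(* the coordinates by the sum of their potentials.                            *)
Lemma expectation_game_value_le : (2 <= n)%N ->
  ('E_P[fun w => game_value R (v ^~ w) (c ^~ w) T]
     <= (24 * (Num.sqrt n%:R * ln n%:R))%:E)%E.
Proof.
move=> n2.
have n0 : 0 < n%:R :> R by rewrite ltr0n (ltn_trans _ n2).
have r0 : 0 < Num.sqrt n%:R :> R by rewrite sqrtr_gt0.
have l0 : 0 < l by rewrite invr_gt0; lra.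
(* This gives [1 <= 2 ln n], which absorbs additive constants into [ln n]. *)
have ln2_ge : 2^-1 <= ln 2 :> R.
  have : expR (2^-1) <= 2 :> R.
    rewrite -[leRHS]invrK -[expR _]invrK -expRN lef_pV2 ?posrE ?expR_gt0//.
    by have := @expR_ge1Dx R (- 2^-1); lra.
  by rewrite -{2}(expRK (2^-1)) ler_ln ?posrE ?expR_gt0.
have lnn : ln 2 <= ln n%:R :> R by rewrite ler_ln ?posrE// ler_nat.
have ln8n : ln (8 * n%:R) <= 4 * ln n%:R :> R.
  rewrite lnM ?posrE// (_ : 8 = 2 ^+ 3); last by rewrite -natrX.
  by rewrite lnXn//; lra.
pose g (e : rounds n T) : R := \big[Num.max/0]_(i < n) `|finite_position R e T ord0 i|.
have g0 e : 0 <= g e by exact: bigmax_ge_id.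
have -> : (fun w => game_value R (v ^~ w) (c ^~ w) T) = g \o rounds_of.
  by apply/funext => w; rewrite game_valueE position_rounds_of.
rewrite (expectation_uniform_rv discrete_rounds_of uniform_rounds_of)// lee_fin.
rewrite ler_pdivrMr ?card_rounds_gt0// -(ler_pM2l l0).
(* Here 6 = 4 + 2: [4 ln n] bounds [ln (8 n)], and [2 ln n] bounds the mean, at most 1, of the
   potentials summed and divided by [8 n]. Dividing by [l] produces 24. *)
have -> : l * (24 * (Num.sqrt n%:R * ln n%:R) * #|rounds n T|%:R) =
    6 * ln n%:R * #|rounds n T|%:R.
  by rewrite /l; field; rewrite gt_eqF.
have gle e : l * g e <= 4 * ln n%:R +
    (8 * n%:R)^-1 * \sum_i potential l (finite_position R e T ord0 i).
  (* Nonnegativity handles the default value 0 of the maximum. *)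
  have S0 : 0 <= (8 * n%:R)^-1 * \sum_i potential l (finite_position R e T ord0 i).
    rewrite mulr_ge0 ?invr_ge0 ?mulr_ge0 ?sumr_ge0// => i _; exact: potential_ge0.
  rewrite mulrC -ler_pdivlMr//; apply: bigmax_le => [|i _].
    by rewrite divr_ge0 ?(ltW l0)//; lra.
  rewrite ler_pdivlMr// mulrC.
  have := expR_ge1Dx (l * `|finite_position R e T ord0 i| - ln (8 * n%:R)).
  rewrite expRD expRN lnK ?posrE ?mulr_gt0// => tangent.
  have : (8 * n%:R)^-1 * expR (l * `|finite_position R e T ord0 i|) <=
      (8 * n%:R)^-1 * \sum_i potential l (finite_position R e T ord0 i).
    rewrite ler_pM2l ?invr_gt0 ?mulr_gt0//.
    apply: le_trans (expR_norm_le_potential _ (ltW l0)) _.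
    rewrite (bigD1 i)//= lerDl.
    by apply: sumr_ge0 => j _; exact: potential_ge0.
  by lra.
rewrite mulr_sumr; apply: (le_trans (ler_sum _ (fun e _ => gle e))).
rewrite big_split [X in X + _ <= _]sumr_const -[X in X + _ <= _]mulr_natr.
rewrite -[X in _ + X <= _]mulr_sumr.
have := sum_sum_potential_le.
rewrite -(ler_pM2l (_ : 0 < (8 * n%:R)^-1)) ?invr_gt0 ?mulr_gt0//.
rewrite [leRHS]mulrA mulVf ?mul1r; last by rewrite mulf_neq0 ?gt_eqF.
have := ler_wpM2r (ltW card_rounds_gt0) (_ : 1 <= 2 * ln n%:R :> R) => /(_ ltac:(lra)).
by lra.
Qed.

End RandomGame.

Theorem theorem2 (R : realType) :
  (exists2 C : R, 0 < C &
    forall (n T : nat) (d : measure_display) (Omega : measurableType d)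
      (P : probability Omega R)
      (v : nat -> Omega -> signvec n) (c : nat -> Omega -> bool),
      (2 <= n)%N -> random_game P T v c ->
      ('E_P[fun w => game_value R (v ^~ w) (c ^~ w) T]
         <= (C * (Num.sqrt n%:R * ln n%:R))%:E)%E)
  /\
  (exists a C : R, [/\ 0 < a, 0 < C &
    forall (n T : nat) (d : measure_display) (Omega : measurableType d)
      (P : probability Omega R)
      (v : nat -> Omega -> signvec n) (c : nat -> Omega -> bool) (k : R),
      (1 <= n)%N -> random_game P T v c -> 0 < k ->
      (P [set w | exists i : 'I_n,
            (k * Num.sqrt n%:R <= `|position R (v ^~ w) (c ^~ w) T ord0 i|)%R]
         <= (C * (n%:R * expR (- (a * k))))%:E)%E]).
Proof.
split.
  by exists 24 => // *; exact: expectation_game_value_le.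
by exists 4^-1, 8; split => // *; exact: position_tail.
Qed.
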